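(* Let $\mathbb{K}$ be a field and let $a$ and $b$ be positive integers. The cycle complex $\mathfrak{C}_{a,b}$ is PR (over $\mathbb{K}$) with degree type $(a,b)$.
   Context: Cycle complexes: write $a=mb+r$ with integers $m\ge0$ and $1\le r\le b$. Let $n=(2m+3)b$, $F=\{1,\dots,a+b\}\subset[n]=\{1,\dots,n\}$, let $g$ be the $n$-cycle $(1\,2\,\dots\,n)\in S_n$, and let $H$ be the cyclic subgroup of $S_n$ generated by $g^b$. The cycle complex $\mathfrak{C}_{a,b}$ is the simplicial complex on vertex set $[n]$ whose faces are all subsets of the sets $hF$, $h\in H$. PR complexes: $\widetilde{H}_i$ is reduced simplicial homology with coefficients in $\mathbb{K}$ (with $\widetilde H_{-1}(\{\emptyset\})=\mathbb{K}$), and $\mathrm{link}_\Delta\sigma=\{\tau\in\Delta:\sigma\cap\tau=\emptyset,\sigma\cup\tau\in\Delta\}$ for a face $\sigma$. A simplicial complex $\Delta$ is PR (over $\mathbb{K}$) if for every $i\ge-1$ and all faces $\sigma,\tau\in\Delta$ with $\widetilde H_i(\mathrm{link}_\Delta\sigma)\ne0\ne\widetilde H_i(\mathrm{link}_\Delta\tau)$ we have $|\sigma|=|\tau|$. For a PR complex $\Delta$, let $p$ be the maximum index for which some face $\sigma$ has $\widetilde H_{p-1}(\mathrm{link}_\Delta\sigma)\neq0$. For each $0\le i\le p$ faces $\sigma$ with $\widetilde H_{i-1}(\mathrm{link}_\Delta\sigma)\ne0$ exist; let $s_i$ be their common size. The degree type of $\Delta$ is $(d_p,\dots,d_1)$ with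 $d_i=s_{i-1}-s_i$ (these are positive integers). *)

(* Defs.v *)
From HB Require Import structures.
From mathcomp Require Import all_boot all_order all_algebra all_fingroup.

Set Implicit Arguments.
Unset Strict Implicit.
Unset Printing Implicit Defensive.

Import Order.TTheory GRing.Theory Num.Theory.
Local Open Scope ring_scope.

(* The vertex set {1, ..., n} is rendered as 'I_n = {0, ..., n - 1}; a complex
   is given by its set of faces. *)
Definition is_complex n (D : {set {set 'I_n}}) : Prop :=
  set0 \in D /\ (forall s t : {set 'I_n}, s \in D -> t \subset s -> t \in D).

Definition link n (D : {set {set 'I_n}}) (s : {set 'I_n}) : {set {set 'I_n}} :=
  [set t in D | [disjoint s & t] && (s :|: t \in D)].

Lemma link_complex n (D : {set {set 'I_n}}) s :
  is_complex D -> s \in D -> is_complex (link D s).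
Proof.
move=> [D0 Dsub] sD; split.
  by rewrite inE D0 disjoint_sym disjoints_subset sub0set setU0 sD.
move=> t u; rewrite !inE => /and3P[tD dst stD] ut; apply/and3P; split.
- exact: Dsub ut.
- by rewrite disjoint_sym (disjointWl ut) // disjoint_sym.
- by apply: Dsub stD _; rewrite setUS.
Qed.

Section Homology.

Variables (K : fieldType) (n : nat).
Implicit Types (D : {set {set 'I_n}}) (s t : {set 'I_n}).

(* Ambient space with one basis vector for each subset of the vertex set; the
   chains of a complex form a subspace. *)
Definition chain : vectType K := {ffun {set 'I_n} -> K^o}.

Definition simplex s : chain := [ffun t => (t == s)%:R].

Definition face_sign s (x : 'I_n) : K := (-1) ^+ #|[set y in s | (y < x)%N]|.

Definition simplex_boundary s : chain :=
  \sum_(x in s) face_sign s x *: simplex (s :\ x).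

Definition boundary (c : chain) : chain := \sum_s c s *: simplex_boundary s.

Fact boundary_is_linear : linear boundary.
Proof.
move=> k c d; rewrite /boundary scaler_sumr -big_split /=.
by apply: eq_bigr => s _; rewrite !ffunE scalerDl scalerA.
Qed.
HB.instance Definition _ :=
  GRing.isLinear.Build K chain chain *:%R boundary boundary_is_linear.

(* In what follows the index j counts vertices, so that j corresponds to
   homological degree j - 1. *)
Definition chains D j : {vspace chain} :=
  <<[seq simplex s | s <- enum D & #|s| == j]>>%VS.

Definition cycles D j : {vspace chain} :=
  (chains D j :&: lker (linfun boundary))%VS.

Definition boundaries D j : {vspace chain} :=
  (linfun boundary @: chains D j.+1)%VS.

(* Reduced homology in degree j - 1: the quotient of cycles by boundaries,
   realized as a complement of the boundaries in the cycles. *)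
Definition reduced_homology D j : {vspace chain} :=
  (cycles D j :\: boundaries D j)%VS.

Lemma boundary_simplex s : boundary (simplex s) = simplex_boundary s.
Proof.
rewrite /boundary (bigD1 s) //= ffunE eqxx scale1r big1 ?addr0 // => t ts.
by rewrite ffunE (negPf ts) scale0r.
Qed.

Lemma face_signD1_lt s (x y : 'I_n) :
  (y < x)%N -> face_sign (s :\ x) y = face_sign s y.
Proof.
move=> yx; congr (_ ^+ _); apply: eq_card => z; rewrite !inE.
by case: eqP => //= ->; rewrite ltnNge (ltnW yx) andbF.
Qed.

Lemma face_signD1_gt s (x y : 'I_n) :
  y \in s -> (y < x)%N -> face_sign s x = - face_sign (s :\ y) x.
Proof.
move=> ys yx; rewrite /face_sign (cardsD1 y) inE ys yx exprS mulN1r.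
by congr (- (_ ^+ _)); apply: eq_card => z; rewrite !inE andbA.
Qed.

Lemma boundary_boundary_simplex s : boundary (simplex_boundary s) = 0.
Proof.
pose F x y := (face_sign s x * face_sign (s :\ x) y) *: simplex (s :\ x :\ y).
have -> : boundary (simplex_boundary s) =
    \sum_(x in s) \sum_(y in s | y != x) F x y.
  rewrite /simplex_boundary linear_sum; apply: eq_bigr => x xs.
  rewrite linearZ /= boundary_simplex scaler_sumr.
  by apply: eq_big => [y|y _]; rewrite ?inE 1?andbC // scalerA.
have -> : \sum_(x in s) \sum_(y in s | y != x) F x y =
    \sum_(x in s) \sum_(y in s | (y < x)%N) F x y +
    \sum_(x in s) \sum_(y in s | (x < y)%N) F x y.
  rewrite -big_split; apply: eq_bigr => x xs /=.
  rewrite (bigID (fun y : 'I_n => (y < x)%N)) /=.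
  congr (_ + _); apply: eq_bigl => y; rewrite -(inj_eq val_inj) /=;
    by case: (y \in s); case: ltngtP.
rewrite [X in _ + X](exchange_big_dep (mem s)) /=; last by move=> x y _ /andP[].
rewrite -big_split big1 // => x xs /=; apply/eqP; rewrite addr_eq0 -sumrN.
apply/eqP; apply: eq_big => [y|y /andP[ys yx]]; first by rewrite xs.
rewrite /F face_signD1_lt // (face_signD1_gt ys yx) -scaleNr.
by rewrite mulNr mulrC !setDDl setUC.
Qed.

Lemma boundaries_sub_cycles D j :
  is_complex D -> (boundaries D j <= cycles D j)%VS.
Proof.
move=> [_ Dsub]; rewrite /boundaries limg_span; apply/span_subvP => c.
rewrite -map_comp => /mapP[s]; rewrite mem_filter mem_enum => /andP[sj sD] ->.
rewrite /= lfunE /= boundary_simplex memv_cap memv_ker lfunE /=.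
rewrite boundary_boundary_simplex eqxx andbT.
apply: memv_suml => x xs; apply: memvZ; apply: memv_span; apply: map_f.
rewrite mem_filter mem_enum (Dsub s) ?subD1set // andbT.
by move: sj; rewrite (cardsD1 x) xs.
Qed.

Lemma dim_reduced_homology D j : is_complex D ->
  (\dim (reduced_homology D j) + \dim (boundaries D j) = \dim (cycles D j))%N.
Proof.
move=> /(boundaries_sub_cycles j)/capv_idPr <-.
by rewrite addnC dimv_cap_compl.
Qed.

Definition PR D : Prop :=
  forall j s t, s \in D -> t \in D ->
    reduced_homology (link D s) j != 0%VS ->
    reduced_homology (link D t) j != 0%VS -> #|s| = #|t|.

Definition homology_faces D j : {set {set 'I_n}} :=
  [set s in D | reduced_homology (link D s) j != 0%VS].

(* The bound j <= n is harmless: a complex on n vertices has no chains with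
   more than n vertices. *)
Definition PR_index D : nat :=
  \max_(j < n.+1 | homology_faces D j != set0) j.

(* For a PR complex all elements of homology_faces D j have the same size, and
   the maximum picks out that size. *)
Definition PR_size D j : nat := \max_(s in homology_faces D j) #|s|.

(* The sequence (d_p, ..., d_1). *)
Definition degree_type D : seq int :=
  [seq (PR_size D i.-1)%:Z - (PR_size D i)%:Z | i <- rev (iota 1 (PR_index D))].

End Homology.

Section CycleComplex.

Variables a b : nat.

(* The m such that a = m * b + r with 1 <= r <= b. *)
Definition cycle_quot : nat := (a.-1 %/ b)%N.

Definition cycle_order : nat := ((2 * cycle_quot + 3) * b)%N.

Definition cycle_facet : {set 'I_cycle_order} :=
  [set i : 'I_cycle_order | (i < a + b)%N].

(* ordS is the cyclic successor i |-> i + 1 modulo cycle_order. *)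
Definition cycle_perm : {perm 'I_cycle_order} :=
  perm (can_inj (@ordSK cycle_order)).

Definition cycle_complex_group : {group {perm 'I_cycle_order}} :=
  <[cycle_perm ^+ b]>%G.

Definition cycle_complex : {set {set 'I_cycle_order}} :=
  \bigcup_(h in cycle_complex_group) powerset [set h x | x in cycle_facet].

Lemma cycle_complexP : is_complex cycle_complex.
Proof.
split.
  by apply/bigcupP; exists 1%g; rewrite ?group1 // powersetE sub0set.
move=> s t /bigcupP[h hH]; rewrite powersetE => sF ts.
by apply/bigcupP; exists h; rewrite // powersetE (subset_trans ts).
Qed.

End CycleComplex.

Lemma cycle_quotE m b r :
  (1 <= r <= b)%N -> cycle_quot (m * b + r) b = m.
Proof.
case: r => // r /= rb; rewrite /cycle_quot addnS /= divnMDl ?divn_small ?addn0 //.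
exact: leq_ltn_trans rb.
Qed.

(* Main.v *)
(* Fix a nonempty face c with a point x and count blocks of b points so that x
   lies in block m + 1. The facets that contain c are then arcs that do not wrap
   around; added in increasing order, each meets the union of the previous ones
   exactly in its intersection with its predecessor. So the link of c is acyclic
   unless c is a facet or the intersection of two consecutive facets, where the
   link is {set0} or two disjoint simplices. The same attachment process applied
   to all arcs shows that the whole complex has the homology of a circle. *)
From HB Require Import structures.
Require Import Defs.
From mathcomp Require Import all_boot all_order all_algebra all_fingroup zify.

Set Implicit Arguments.
Unset Strict Implicit.
Unset Printing Implicit Defensive.

Import GRing.Theory.
Local Open Scope ring_scope.

(** * Chains through their coefficients, and vanishing of reduced homology *)

Section SimplicialHomology.

Variables (K : fieldType) (n : nat).
Implicit Types (D : {set {set 'I_n}}) (s t F : {set 'I_n}) (c d : chain K n).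
Implicit Types (x : 'I_n) (j : nat).

(** With [graded], this expresses membership in the span [chains D j] by conditions on coefficients,
    which are easy to follow when a chain is split between two subcomplexes. *)
Definition supported D c := forall s, c s != 0 -> s \in D.

Definition graded j c := forall s, c s != 0 -> #|s| = j.

(** Unlike [is_complex], this admits the void family [set0]. Attachments start there because it has
    no homology at any index, whereas the family with the single face [set0] has homology at index
    0. *)
Definition downclosed D := forall s t, s \in D -> t \subset s -> t \in D.

Lemma chain_sum c : c = \sum_s c s *: simplex K s.
Proof.
apply/ffunP => t; rewrite sum_ffunE (bigD1 t) //= big1 ?addr0.
  by rewrite !ffunE eqxx [_ *: _]mulr1.
by move=> s st; rewrite !ffunE eq_sym (negPf st) [_ *: _]mulr0.
Qed.

Lemma linear_simplex_eq (f g : {linear chain K n -> chain K n}) :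
  (forall s, f (simplex K s) = g (simplex K s)) -> f =1 g.
Proof.
move=> fg c; rewrite [c]chain_sum !linear_sum.
by apply: eq_bigr => s _; rewrite !linearZ fg.
Qed.

Lemma simplex_neq0 s t : simplex K s t != 0 -> t = s.
Proof. by apply: contraNeq => /negPf ts; rewrite ffunE ts. Qed.

Lemma chainsP D j c : reflect (supported D c /\ graded j c) (c \in chains K D j).
Proof.
apply: (iffP idP) => [|[cD cj]].
  pose X := in_tuple [seq simplex K s | s <- enum D & #|s| == j].
  move=> /(@coord_span _ _ _ X) ->.
  suff H t : (\sum_i coord X i c *: X`_i) t != 0 -> t \in D /\ #|t| = j.
    by split=> t /H[].
  rewrite sum_ffunE => Ht.
  have [i _ Hi] : exists2 i, true & (coord X i c *: X`_i) t != 0.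
    apply/exists_inP; apply: contraNT Ht; rewrite negb_exists_in.
    by move=> /forall_inP H; apply/eqP/big1 => i _; apply/eqP; rewrite -[_ == _]negbK H.
  have /mapP[s] : X`_i \in [seq simplex K s | s <- enum D & #|s| == j].
    exact: mem_nth.
  rewrite mem_filter mem_enum => /andP[/eqP sj sD] Xi.
  move: Hi; rewrite Xi ffunE => Hi.
  have -> : t = s by apply: simplex_neq0; apply: contraNneq Hi => ->; rewrite scaler0.
  by [].
rewrite [c]chain_sum; apply: memv_suml => s _.
have [->|cs] := eqVneq (c s) 0; first by rewrite scale0r mem0v.
apply/memvZ/memv_span/map_f; rewrite mem_filter mem_enum.
by rewrite (cj s cs) eqxx (cD s cs).
Qed.

Lemma reduced_homology_eq0P D j :
  reduced_homology K D j = 0%VS <->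
  (forall c, supported D c -> graded j c -> boundary c = 0 ->
   exists d, [/\ supported D d, graded j.+1 d & boundary d = c]).
Proof.
split=> [/eqP|H].
  rewrite /reduced_homology diffv_eq0 => /subvP H c cD cj c0.
  have /H/memv_imgP[d /chainsP[dD dj] ->] : c \in cycles K D j.
    by rewrite memv_cap memv_ker lfunE /= c0 eqxx andbT; apply/chainsP.
  by exists d; split; rewrite ?lfunE.
apply/eqP; rewrite /reduced_homology diffv_eq0; apply/subvP => c.
rewrite memv_cap memv_ker lfunE /= => /andP[/chainsP[cD cj] /eqP c0].
have [d [dD dj <-]] := H c cD cj c0.
apply/memv_imgP; exists d; first exact/chainsP.
by rewrite lfunE.
Qed.

Lemma supportedD D c d : supported D c -> supported D d -> supported D (c + d).
Proof.
move=> cD dD s; rewrite ffunE.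
have [->|/cD//] := eqVneq (c s) 0; rewrite add0r; exact: dD.
Qed.

Lemma supportedN D c : supported D c -> supported D (- c).
Proof. by move=> cD s; rewrite ffunE oppr_eq0 => /cD. Qed.

Lemma supportedB D c d : supported D c -> supported D d -> supported D (c - d).
Proof. by move=> cD /supportedN; apply: supportedD. Qed.

Lemma gradedD j c d : graded j c -> graded j d -> graded j (c + d).
Proof.
move=> cD dD s; rewrite ffunE.
have [->|/cD//] := eqVneq (c s) 0; rewrite add0r; exact: dD.
Qed.

Lemma gradedN j c : graded j c -> graded j (- c).
Proof. by move=> cD s; rewrite ffunE oppr_eq0 => /cD. Qed.

Lemma supported_sub D D' c : D \subset D' -> supported D c -> supported D' c.
Proof. by move=> /subsetP DD cD s /cD/DD. Qed.

Lemma supportedI D D' c : supported D c -> supported D' c -> supported (D :&: D') c.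
Proof. by move=> cD cD' s cs; rewrite inE cD // cD'. Qed.

Lemma boundary_neq0 c t : boundary c t != 0 ->
  exists s x, [/\ c s != 0, x \in s & t = s :\ x].
Proof.
rewrite /boundary sum_ffunE => Ht.
have [s _ Hs] : exists2 s, true & (c s *: simplex_boundary K s) t != 0.
  apply/exists_inP; apply: contraNT Ht; rewrite negb_exists_in => /forall_inP H.
  by apply/eqP/big1 => i _; apply/eqP; rewrite -[_ == _]negbK H.
have cs : c s != 0 by apply: contraNneq Hs => ->; rewrite scale0r ffunE.
have {}Hs : simplex_boundary K s t != 0.
  by apply: contraNneq Hs => H0; rewrite ffunE H0 scaler0.
have [x xs Hx] : exists2 x, x \in s & (face_sign K s x *: simplex K (s :\ x)) t != 0.
  apply/exists_inP; apply: contraNT Hs; rewrite negb_exists_in => /forall_inP H.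
  rewrite sum_ffunE.
  by apply/eqP/big1 => i /H; rewrite negbK => /eqP.
exists s, x; split=> //; apply: simplex_neq0.
by apply: contraNneq Hx => H0; rewrite ffunE H0 scaler0.
Qed.

Lemma supported_boundary D c : downclosed D -> supported D c -> supported D (boundary c).
Proof.
move=> Ddown cD t /boundary_neq0[s [x [cs _ ->]]].
exact: Ddown (cD s cs) (subD1set _ _).
Qed.

Lemma graded_boundary j c : graded j.+1 c -> graded j (boundary c).
Proof.
move=> cj t /boundary_neq0[s [x [cs xs ->]]].
by have := cj s cs; rewrite (cardsD1 x) xs => -[].
Qed.

(** * The cone operator as a contracting homotopy *)

Definition simplex_cone x s : chain K n :=
  if x \in s then 0 else face_sign K (x |: s) x *: simplex K (x |: s).

Definition cone x c : chain K n := \sum_s c s *: simplex_cone x s.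

Fact cone_is_linear x : linear (cone x).
Proof.
move=> k c d; rewrite /cone scaler_sumr -big_split /=.
by apply: eq_bigr => s _; rewrite !ffunE scalerDl scalerA.
Qed.
HB.instance Definition _ x :=
  GRing.isLinear.Build K (chain K n) (chain K n) *:%R (cone x) (cone_is_linear x).

Lemma cone_simplex x s : cone x (simplex K s) = simplex_cone x s.
Proof.
rewrite /cone (bigD1 s) //= ffunE eqxx scale1r big1 ?addr0 // => t ts.
by rewrite ffunE (negPf ts) scale0r.
Qed.

Lemma face_sign_mul s x : face_sign K s x * face_sign K s x = 1.
Proof. by rewrite -expr2 sqrr_sign. Qed.

(** Deleting the smaller vertex flips the sign of the larger one; deleting the larger leaves the
    sign of the smaller unchanged. *)
Lemma face_sign_swap s x y : x \in s -> y \in s -> x != y ->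
  face_sign K s x * face_sign K s y = - (face_sign K (s :\ x) y * face_sign K (s :\ y) x).
Proof.
wlog xy : x y / (y < x)%N => [H xs ys xNy|xs ys _].
  have [yx|xy|/val_inj e] := ltngtP y x; first exact: H.
    by rewrite mulrC H // 1?eq_sym // mulrC.
  by rewrite e eqxx in xNy.
by rewrite face_signD1_lt // (face_signD1_gt K ys xy) mulrC mulrN.
Qed.

(** The sign in [simplex_cone] makes [s] occur with coefficient 1 in the boundary of its cone. The
    faces of [x |: s] that keep [x] cancel against the cones over the faces of [s], by
    [face_sign_swap]. If [x] is in [s], only the face [s :\ x] has a nonzero cone, and this cone is
    [s]. *)
Lemma cone_homotopy x c : boundary (cone x c) + cone x (boundary c) = c.
Proof.
apply: (@linear_simplex_eq ((@boundary K n \o cone x) \+ (cone x \o @boundary K n)) idfun).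
move=> s /=.
rewrite cone_simplex boundary_simplex /simplex_cone /simplex_boundary linear_sum /=.
have [xs|xs] := boolP (x \in s).
  rewrite linear0 add0r (bigD1 x) //= big1 ?addr0 => [|y /andP[ys yx]].
    rewrite linearZ /= cone_simplex /simplex_cone setD11 setD1K //.
    by rewrite scalerA face_sign_mul scale1r.
  by rewrite linearZ /= cone_simplex /simplex_cone !inE eq_sym yx xs scaler0.
rewrite linearZ /= boundary_simplex /simplex_boundary big_setU1 //= scalerDr.
rewrite scalerA face_sign_mul scale1r setU1K // -addrA scaler_sumr -big_split /=.
rewrite big1 ?addr0 // => y ys.
have yx : y != x by apply: contraNneq xs => <-.
rewrite (linearZ_LR (cone x)) /= cone_simplex /simplex_cone !inE (negPf xs) andbF.
have -> : x |: s :\ y = (x |: s) :\ y.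
  apply/setP => z; rewrite !inE.
  by have [->|] := eqVneq z x; rewrite //= ?(eq_sym x) ?yx.
rewrite !scalerA -scalerDl face_sign_swap ?inE ?eqxx ?ys ?orbT // 1?eq_sym //.
by rewrite setU1K // addNr scale0r.
Qed.

Lemma cone_neq0 x c t : cone x c t != 0 ->
  exists s, [/\ c s != 0, x \notin s & t = x |: s].
Proof.
rewrite /cone sum_ffunE => Ht.
have [s _ Hs] : exists2 s, true & (c s *: simplex_cone x s) t != 0.
  apply/exists_inP; apply: contraNT Ht; rewrite negb_exists_in => /forall_inP H.
  by apply/eqP/big1 => i _; apply/eqP; rewrite -[_ == _]negbK H.
have cs : c s != 0 by apply: contraNneq Hs => ->; rewrite scale0r ffunE.
have {}Hs : simplex_cone x s t != 0.
  by apply: contraNneq Hs => H0; rewrite ffunE H0 scaler0.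
move: Hs; rewrite /simplex_cone; case: ifPn => [|xs Hs]; first by rewrite ffunE eqxx.
exists s; split=> //; apply: simplex_neq0.
by apply: contraNneq Hs => H0; rewrite ffunE H0 scaler0.
Qed.

Lemma graded_cone x j c : graded j c -> graded j.+1 (cone x c).
Proof. by move=> cj t /cone_neq0[s [cs xs ->]]; rewrite cardsU1 xs cj. Qed.

Lemma cone_fills x c : boundary c = 0 -> boundary (cone x c) = c.
Proof. by move=> c0; rewrite -{2}(cone_homotopy x c) c0 linear0 addr0. Qed.

Lemma boundary_boundary c : boundary (boundary c) = 0.
Proof.
apply: (@linear_simplex_eq (@boundary K n \o @boundary K n) \0) => s /=.
by rewrite boundary_simplex boundary_boundary_simplex.
Qed.

(** * Homology when a simplex or a single cell is attached *)

Definition restrict D c : chain K n := [ffun s => if s \in D then c s else 0].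

Lemma supported_restrict D c : supported D (restrict D c).
Proof. by move=> s; rewrite ffunE; case: ifP => //; rewrite eqxx. Qed.

Lemma supported_restrictC D D' c :
  supported (D :|: D') c -> supported D' (c - restrict D c).
Proof.
move=> cD s; rewrite !ffunE; case: ifPn => [|sD]; rewrite ?subrr ?eqxx // subr0.
by move=> /cD; rewrite inE (negPf sD).
Qed.

Lemma graded_restrict j D c : graded j c -> graded j (restrict D c).
Proof. by move=> cj s; rewrite ffunE; case: ifP; rewrite ?eqxx // => _ /cj. Qed.

Definition has_homology D j := reduced_homology K D j != 0%VS.

Lemma downclosedU D D' : downclosed D -> downclosed D' -> downclosed (D :|: D').
Proof.
move=> HD HD' s t /setUP[] H st; apply/setUP; [left|right].
  exact: HD st.
exact: HD' st.
Qed.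

Lemma downclosed_powerset F : downclosed (powerset F).
Proof. by move=> s t; rewrite !powersetE => sF /subset_trans; apply. Qed.

(** This is Mayer-Vietoris on chains: the full simplex on [F] is a cone with apex [x], and the
    hypothesis makes its intersection with [D] void or a cone with the same apex. *)
Lemma has_homology_add_cone D F x : downclosed D -> x \in F ->
    (forall s, s \subset F -> s \in D -> x |: s \in D) ->
  has_homology (D :|: powerset F) =1 has_homology D.
Proof.
move=> Dd xF HF j; congr (~~ _).
have pFd := @downclosed_powerset F.
have coneF c : supported (powerset F) c -> supported (powerset F) (cone x c).
  move=> cF t /cone_neq0[s [/cF sF _ ->]].
  by move: sF; rewrite !powersetE subUset sub1set xF.
have coneD c : supported (D :&: powerset F) c -> supported D (cone x c).
  move=> cDF t /cone_neq0[s [/cDF sF _ ->]].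
  by move: sF; rewrite inE powersetE => /andP[sD sF]; apply: HF.
(* The part of c outside D lies in F; its boundary z lies in D and F, and is
   filled by its cone within both. *)
have split c i : supported (D :|: powerset F) c -> graded i c ->
    supported D (boundary c) ->
    exists e, [/\ supported D e, graded i e, boundary e = boundary c &
      supported (powerset F) (c - e)].
  move=> cDF ci bD; set c1 := restrict D c; set z := boundary (c - c1).
  have c1D : supported D c1 by apply: supported_restrict.
  have c2F : supported (powerset F) (c - c1) by apply: supported_restrictC.
  have zF : supported (powerset F) z by apply: supported_boundary.
  have zD : supported D z.
    by rewrite /z linearB; apply: supportedB => //; apply: supported_boundary.
  have zi : graded i (cone x z).
    (* For [i = 0] only the empty face occurs; its boundary is zero, so there is no lower grade to
       cone up from. *)
    case: i ci => [|i] ci.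
      move=> t /cone_neq0[s [/boundary_neq0[u [y [Hu yu _]]] _ _]].
      have : #|u| = 0%N.
        by move: Hu; rewrite !ffunE; case: ifP => _; rewrite ?subrr ?eqxx // subr0 => /ci.
      by move/eqP; rewrite cards_eq0 => /eqP u0; rewrite u0 inE in yu.
    apply: graded_cone; apply: graded_boundary; apply: gradedD => //.
    by apply: gradedN; apply: graded_restrict.
  exists (c1 + cone x z); split.
  - by apply: supportedD => //; apply: coneD; apply: supportedI.
  - by apply: gradedD => //; apply: graded_restrict.
  - rewrite linearD /= cone_fills ?boundary_boundary // /z linearB /=.
    by rewrite addrC subrK.
  - rewrite opprD addrA; apply: supportedB => //; exact: coneF.
apply/eqP/eqP => /reduced_homology_eq0P H; apply/reduced_homology_eq0P => c cD cj c0.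
have [|d [dD dj dc]] := H c _ cj c0.
    by apply: supported_sub cD; apply: subsetUl.
  (* The filling found in the union is traded for one in [D] with the same boundary. *)
  have [|e [eD ej ed _]] := split d j.+1 dD dj; first by rewrite dc.
  by exists e; split=> //; rewrite ed.
(* Conversely, the cycle is moved into [D], and the remaining cycle in the simplex on [F] is filled
   by its cone. *)
have [|e [eD ej ec ceF]] := split c j cD cj.
  by rewrite c0 => s; rewrite ffunE eqxx.
have [|d [dD dj de]] := H e eD ej; first by rewrite ec.
exists (d + cone x (c - e)); split.
- apply: supportedD; first by apply: supported_sub dD; apply: subsetUl.
  by apply: (supported_sub _ (coneF _ ceF)); apply: subsetUr.
- by apply: gradedD => //; apply: graded_cone; apply: gradedD => //; apply: gradedN.
- by rewrite linearD /= cone_fills ?linearB /= ?de ?ec ?subrr // addrC subrK.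
Qed.

(** As [D] is acyclic, the boundary of [s] bounds some [w] in [D], and [s - w] is the new cycle. A
    filling of it would consist of faces larger than [s], hence lie in [D], and so would its
    boundary; but the coefficient of [s - w] at [s] is 1. *)
Lemma has_homology_add_cell D s : downclosed D -> downclosed (s |: D) -> s \notin D ->
    (forall j, has_homology D j = false) ->
  forall j, has_homology (s |: D) j = (j == #|s|).
Proof.
move=> Dd sDd sD DH j.
have fill c i : supported D c -> graded i c -> boundary c = 0 ->
    exists d, [/\ supported D d, graded i.+1 d & boundary d = c].
  by move/negbFE/eqP/reduced_homology_eq0P: (DH i) => /[apply]/[apply]/[apply].
have sub c i : i != #|s| -> supported (s |: D) c -> graded i c -> supported D c.
  move=> js cD cj t ct; have := cD t ct; rewrite !inE => /predU1P[ts|//].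
  by rewrite -(cj t ct) ts eqxx in js.
have [->|js] := eqVneq j #|s|; last first.
  apply/negbTE; rewrite negbK; apply/eqP/reduced_homology_eq0P => c cD cj c0.
  have [d [dD dj <-]] := fill c j (sub _ _ js cD cj) cj c0.
  by exists d; split=> //; apply: supported_sub dD; apply: subsetUr.
apply/eqP => /reduced_homology_eq0P H.
pose sc : chain K n := simplex K s.
have bsD : supported D (boundary sc).
  move=> t Ht; have [u [x [/simplex_neq0-> xs tE]]] := boundary_neq0 Ht.
  have : t \in s |: D by apply: (sDd s); rewrite ?setU11 // tE subD1set.
  by rewrite !inE => /predU1P[ts|//]; have := setD11 x s; rewrite -tE ts xs.
have scj : graded #|s| sc by move=> t /simplex_neq0->.
have [w [wD wj wE]] : exists w, [/\ supported D w, graded #|s| w & boundary w = boundary sc].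
  (* The empty simplex has zero boundary, so [w = 0] works even when [D] is void. *)
  case E : #|s| => [|i].
    exists 0; split; try by move=> t; rewrite ffunE eqxx.
    rewrite linear0 boundary_simplex /simplex_boundary big1 // => x xs.
    by move/eqP: E; rewrite cards_eq0 => /eqP s0; rewrite s0 inE in xs.
  apply: fill => //; last exact: boundary_boundary.
  by apply: graded_boundary; rewrite -E.
have [|||d [dD dj dE]] := H (sc - w).
- apply: supportedB; first by move=> t /simplex_neq0->; rewrite setU11.
  by apply: supported_sub wD; apply: subsetUr.
- by apply: gradedD => //; apply: gradedN.
- by rewrite linearB /= wE subrr.
have {}dD : supported D d by apply: sub dD dj; rewrite -addn1 -{2}[#|s|]addn0 eqn_add2l.
have := supported_boundary Dd dD (s := s).
rewrite dE !ffunE eqxx.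
have -> : w s = 0 by apply: contraNeq sD => /wD.
by rewrite subr0 oner_eq0 (negPf sD) => /(_ isT).
Qed.

Lemma has_homology_set0 j : has_homology set0 j = false.
Proof.
apply/negbTE; rewrite negbK; apply/eqP/reduced_homology_eq0P => c cD cj c0.
exists 0; split; try by move=> t; rewrite ffunE eqxx.
rewrite linear0; apply/ffunP => s; rewrite ffunE; apply/esym/eqP.
by apply: contraT => /cD; rewrite inE.
Qed.

Lemma downclosed_set0 : downclosed set0.
Proof. by move=> s t; rewrite inE. Qed.

(** For empty [F] this is the cell [set0] added to the void family; otherwise it is a cone attached
    to the void family. *)
Lemma has_homology_powerset F j : has_homology (powerset F) j = (F == set0) && (j == 0%N).
Proof.
have [->|/set0Pn[x xF]] := eqVneq F set0.
  rewrite powerset0 -(setU0 [set _]) has_homology_add_cell ?cards0 ?inE //.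
  - exact: downclosed_set0.
  - rewrite setU0 -powerset0; exact: downclosed_powerset.
  - exact: has_homology_set0.
rewrite -(set0U (powerset F)) (has_homology_add_cone _ xF) ?has_homology_set0 //.
  exact: downclosed_set0.
by move=> s _; rewrite inE.
Qed.

(** A point of [G] is added to the acyclic simplex on [F] as a cell, which creates the class; the
    rest of [G] is attached along the cone over that point. *)
Lemma has_homology_two_simplices F G j :
  F != set0 -> G != set0 -> [disjoint F & G] ->
  has_homology (powerset F :|: powerset G) j = (j == 1%N).
Proof.
move=> F0 /set0Pn[x xG] FG.
have xF : x \notin F by apply: contraTN FG => xF; apply/pred0Pn; exists x; rewrite /= xF.
have xd : downclosed ([set x] |: powerset F).
  move=> s t; rewrite !inE => /orP[/eqP->|sF] ts.
    by move: ts; rewrite subset1 => /orP[->//|/eqP->]; rewrite sub0set orbT.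
  by rewrite (subset_trans ts sF) orbT.
have -> : powerset F :|: powerset G = ([set x] |: powerset F) :|: powerset G.
  apply/setP => s; rewrite !inE; have [->|] := eqVneq s [set x]; rewrite ?sub1set //=.
  by rewrite xG orbT.
rewrite (has_homology_add_cone xd xG); last first.
  move=> s sG; rewrite !inE => /orP[/eqP->|sF]; first by rewrite setUid eqxx.
  suff -> : s = set0 by rewrite setU0 eqxx.
  apply/eqP; rewrite -subset0; apply/subsetP => y ys; rewrite inE.
  by have /pred0P/(_ y) := FG; rewrite /= (subsetP sF) // (subsetP sG).
rewrite has_homology_add_cell ?cards1 //.
- exact: downclosed_powerset.
- by rewrite powersetE sub1set.
- by move=> i; rewrite has_homology_powerset (negPf F0).
Qed.

End SimplicialHomology.

Local Close Scope ring_scope.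

(** * The facets as cyclic arcs in block coordinates *)

Lemma card_ord_lt n k : k <= n -> #|[set x : 'I_n | x < k]| = k.
Proof.
move=> kn; have wI : injective (widen_ord kn) by move=> x y e; apply: val_inj; apply: (congr1 val e).
rewrite -[RHS]card_ord -(card_imset _ wI).
apply: eq_card => x; rewrite inE; apply/idP/imsetP => [xk|[y _ ->]]; last exact: (ltn_ord y).
by exists (Ordinal xk) => //; apply: val_inj.
Qed.

Section Arcs.

Variables a b : nat.
Hypotheses (a_gt0 : 0 < a) (b_gt0 : 0 < b).

Local Notation m := (cycle_quot a b).
Local Notation r := (a.-1 %% b).+1.
Local Notation N := (2 * m + 3).
Local Notation n := (cycle_order a b).
Implicit Types (x : 'I_n) (s : {set 'I_n}) (k t q o : nat).

(* The point o of block q lies in the facet of the a + b = (m + 1) * b + r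
   points starting at block t <= 2m + 2, blocks being counted modulo N. *)
Definition in_arc t q o : bool :=
  let d := if t <= q then q - t else q + N - t in
  (d <= m) || (d == m.+1) && (o < r).

(* The block of x, counted from block k. *)
Definition block k x : nat := (x %/ b + (N - k %% N)) %% N.

(** The index is any natural number, read modulo [N], so [arc k] and [arc k.+1] are consecutive
    facets across the wraparound too. *)
Definition arc k : {set 'I_n} := [set x | in_arc 0 (block k x) (x %% b)].

Lemma cycle_sizeE : a = m * b + r.
Proof. by rewrite addnS -divn_eq prednK. Qed.

Lemma r_leb : r <= b.
Proof. exact: ltn_pmod. Qed.

Lemma block_lt k x : block k x < N.
Proof. by rewrite ltn_mod addn3. Qed.

Lemma mem_facet x : (x \in cycle_facet a b) = in_arc 0 (x %/ b) (x %% b).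
Proof.
rewrite inE /in_arc leq0n subn0.
move: (nat_of_ord x) (divn_eq x b) (ltn_pmod x b_gt0) => y.
move: (y %/ b) (y %% b) r_leb cycle_sizeE => q o; move: m r => M R rb aE -> ob.
have [qm|mq] := leqP q M; first by nia.
have [->|qm] := eqVneq q M.+1; first by nia.
by nia.
Qed.

Lemma cycle_permX k x : ((cycle_perm a b ^+ k)%g x : nat) = (x + k) %% n.
Proof.
elim: k => [|k IH]; first by rewrite expg0 perm1 addn0 modn_small.
by rewrite expgSr permM permE /= IH -addn1 modnDml addn1 addnS.
Qed.

Definition rotation k := ((cycle_perm a b ^+ b) ^+ k)%g.

Lemma rotation_coord k x :
  (rotation k x %/ b = (x %/ b + k) %% N) * (rotation k x %% b = x %% b).
Proof.
rewrite /rotation -expgM !cycle_permX; split; last first.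
  by rewrite modn_dvdm ?dvdn_mull // addnC mulnC modnMDl.
by rewrite -(modn_divl (_ + _) N b) addnC mulnC divnMDl // addnC.
Qed.

(** The term [N - k %% N] stands for [-k] modulo [N]. *)
Lemma modn_subKC q k : q + (N - k %% N) + k = q %[mod N].
Proof.
have -> : q + (N - k %% N) + k = (k %/ N).+1 * N + q.
  have := divn_eq k N; have : k %% N < N by rewrite ltn_mod addn3.
  by rewrite (mulSn (k %/ N)); move: (k %% N) (k %/ N * N); lia.
by rewrite modnMDl.
Qed.

Lemma blockP k x q : q < N -> q + k = x %/ b %[mod N] -> block k x = q.
Proof.
move=> qN e; rewrite -(modn_small qN); apply/eqP.
by rewrite -(eqn_modDr k) modn_subKC e.
Qed.

Lemma block_modE k x : block k x + k = x %/ b %[mod N].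
Proof. by rewrite modnDml modn_subKC. Qed.

Lemma block_rotation k l x : block (k + l) (rotation k x) = block l x.
Proof.
apply: blockP; rewrite ?block_lt // rotation_coord modn_mod.
by rewrite addnCA addnC -modnDml block_modE modnDml.
Qed.

Lemma arc0 : arc 0 = cycle_facet a b.
Proof.
apply/setP => x; rewrite mem_facet inE /block mod0n subn0 modnDr modn_small //.
by rewrite ltn_divLR // ltn_ord.
Qed.

Lemma mem_arcD k l x : (rotation k x \in arc (k + l)) = (x \in arc l).
Proof. by rewrite !inE block_rotation rotation_coord. Qed.

Lemma rotation_arc k l : rotation k @: arc l = arc (k + l).
Proof.
apply/setP => y; rewrite -[y](permKV (rotation k)).
by rewrite mem_arcD mem_imset //; apply: perm_inj.
Qed.

Lemma arc_mod k l : k = l %[mod N] -> arc k = arc l.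
Proof. by move=> e; apply/setP => x; rewrite !inE /block e. Qed.

(** The base [k] is free so that the circle of arcs can be cut wherever a later argument needs
    it. *)
Lemma mem_cycle_complex k s :
  reflect (exists2 t, t < N & s \subset arc (k + t)) (s \in cycle_complex a b).
Proof.
apply: (iffP bigcupP) => [[h /cycleP[i ->]]|[t _ st]].
  rewrite powersetE -arc0 -/(rotation i) rotation_arc addn0 => si.
  exists ((i + (N - k %% N)) %% N); first by rewrite ltn_mod addn3.
  by rewrite (@arc_mod _ i) // modnDmr addnC modn_subKC.
exists (rotation (k + t)); first exact: mem_cycle.
by rewrite powersetE -arc0 rotation_arc addn0.
Qed.

Lemma mem_arc k t x : t < N -> (x \in arc (k + t)) = in_arc t (block k x) (x %% b).
Proof.
move=> tN; rewrite inE; have qN := block_lt k x; have e := block_modE k x.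
suff -> : block (k + t) x = if t <= block k x then block k x - t else block k x + N - t.
  by rewrite /in_arc leq0n subn0.
apply: blockP; first by case: ifP; lia.
rewrite -e; case: leqP => qt; first by rewrite addnCA subnK // addnC.
by rewrite addnCA subnK ?(leq_trans (ltnW tN)) ?leq_addl // addnA modnDr addnC.
Qed.

Lemma exists_block k q o : q < N -> o < b -> exists x, block k x = q /\ x %% b = o.
Proof.
move=> qN ob; have pn : (q + k) %% N * b + o < n.
  have : (q + k) %% N < N by rewrite ltn_mod addn3.
  by rewrite /cycle_order; nia.
exists (Ordinal pn); split; last by rewrite /= modnMDl modn_small.
by apply: blockP => //=; rewrite divnMDl // divn_small // addn0 modn_mod.
Qed.

Lemma card_arc k : #|arc k| = a + b.
Proof.
rewrite -[k]addn0 -rotation_arc card_imset; last exact: perm_inj.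
rewrite arc0 card_ord_lt // /cycle_order.
by rewrite {1}cycle_sizeE; move: r_leb; nia.
Qed.

(** After rotation to [k = 0], the points of the first arc outside the second form exactly block
    0. *)
Lemma card_arcI k : #|arc k :&: arc k.+1| = a.
Proof.
rewrite -[k in arc k]addn0 -addn1 -!rotation_arc -imsetI; last by move=> x y _ _; apply: perm_inj.
rewrite card_imset; last exact: perm_inj.
have bn : b <= n by rewrite /cycle_order leq_pmull // addn3.
have E : arc 0 :\: arc 1 = [set x : 'I_n | x < b].
  apply/setP => x; rewrite in_setD -[arc 1]/(arc (0 + 1)) mem_arc ?addn3 // arc0 mem_facet [RHS]inE.
  have -> : block 0 x = x %/ b.
    by apply: blockP; rewrite ?addn0 // ltn_divLR.
  have := ltn_pmod x b_gt0; have := r_leb; have <- : (x %/ b < 1) = (x < b) by rewrite ltn_divLR // mul1n.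
  move: (x %/ b) => q; move: (x %% b) m r => o M R; rewrite /in_arc; case: q => [|q] /=; lia.
have := cardsID (arc 1) (arc 0); rewrite E card_ord_lt // card_arc; lia.
Qed.

End Arcs.

(** * Intersections of arcs, and the links of nonempty faces *)

Section CycleComplexHomology.

Variables (K : fieldType) (a b : nat).
Hypotheses (a_gt0 : 0 < a) (b_gt0 : 0 < b).

Local Notation m := (cycle_quot a b).
Local Notation r := (a.-1 %% b).+1.
Local Notation N := (2 * m + 3).
Local Notation n := (cycle_order a b).
Local Notation arc := (@arc a b).
Local Notation in_arc := (in_arc a b).
Implicit Types (x y : 'I_n) (s c : {set 'I_n}) (i k t q o j : nat).

(** Here [t + m + 1 < i + N], so the arcs do not meet around the back; their common points run from
    block [t] to the end of arc [i]. *)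
Lemma in_arc_pred i t q o : i < t < N -> t <= i + m.+1 -> q < N ->
  in_arc i q o -> in_arc t q o -> in_arc t.-1 q o.
Proof.
rewrite /in_arc; move: m r => M R /andP[it tN] ti qN.
by case: (leqP i q) => ?; case: (leqP t q) => ?; case: (leqP t.-1 q) => ?; lia.
Qed.

(** Such arcs meet only past the wraparound, between block [i] and block [t + m + 1 - N], which is
    at most [m]; arc 0 contains these blocks in full. *)
Lemma in_arc_first i t q o : t < N -> i + m.+1 < t -> q < N ->
  in_arc i q o -> in_arc t q o -> in_arc 0 q o.
Proof.
rewrite /in_arc; move: m r => M R tN ti qN; rewrite leq0n.
by case: (leqP i q) => ?; case: (leqP t q) => ?; lia.
Qed.

Lemma sub_arc_pred k i t s : i < t < N -> t <= i + m.+1 ->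
  s \subset arc (k + i) -> s \subset arc (k + t) -> s \subset arc (k + t.-1).
Proof.
move=> /andP[it tN] ti si st; apply/subsetP => x xs.
have := subsetP si x xs; have := subsetP st x xs.
rewrite !mem_arc //; try lia.
by move=> xt xi; apply: (in_arc_pred _ ti) xi xt; rewrite ?it ?block_lt.
Qed.

Lemma sub_arc_first k i t s : t < N -> i + m.+1 < t ->
  s \subset arc (k + i) -> s \subset arc (k + t) -> s \subset arc k.
Proof.
move=> tN ti si st; apply/subsetP => x xs; rewrite -[k]addn0.
have := subsetP si x xs; have := subsetP st x xs.
rewrite !mem_arc //; try lia.
by move=> xt xi; apply: (in_arc_first tN ti) xi xt; rewrite ?block_lt.
Qed.

(** This is the stage of the attachment process at which the first [t] arcs from block [k] have been
    considered. *)
Definition partial_link k c t : {set {set 'I_n}} :=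
  [set s : {set 'I_n} | [exists i : 'I_t, (c \subset arc (k + i)) && (s \subset arc (k + i) :\: c)]].

Lemma partial_linkP k c t s :
  reflect (exists i, [/\ i < t, c \subset arc (k + i) & s \subset arc (k + i) :\: c])
    (s \in partial_link k c t).
Proof.
rewrite inE; apply: (iffP existsP) => [[i /andP[ci si]]|[i [it ci si]]].
  by exists i.
by exists (Ordinal it); rewrite /= ci.
Qed.

Lemma downclosed_partial_link k c t : downclosed (partial_link k c t).
Proof.
move=> s u /partial_linkP[i [it ci si]] us; apply/partial_linkP; exists i.
by split=> //; apply: subset_trans si.
Qed.

Lemma partial_linkS k c t : partial_link k c t.+1 =
  if c \subset arc (k + t) then partial_link k c t :|: powerset (arc (k + t) :\: c)
  else partial_link k c t.
Proof.
apply/setP => s; apply/partial_linkP/idP => [[i [it ci si]]|].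
  have [e|ne] := eqVneq i t; first by rewrite -e ci inE powersetE si orbT.
  have si' : s \in partial_link k c t by apply/partial_linkP; exists i; split=> //; lia.
  by case: ifP => // _; rewrite inE si'.
have old : s \in partial_link k c t ->
    exists i, [/\ i < t.+1, c \subset arc (k + i) & s \subset arc (k + i) :\: c].
  by move=> /partial_linkP[i [it ci si]]; exists i; split=> //; lia.
case: ifP => // ct /setUP[//|]; rewrite powersetE => st; by exists t.
Qed.

(** The bound [m.+2] keeps all starting blocks within [m.+1] of each other, so [sub_arc_pred]
    applies to every pair; each attachment then has an apex outside [c]. *)
Lemma partial_link_acyclic k c t : t <= m.+2 -> #|c| != a + b ->
    (forall i, c <> arc i :&: arc i.+1) ->
  forall j, has_homology K (partial_link k c t) j = false.
Proof.
move=> tm cF cI; elim: t tm => [|t IH] tm j.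
  suff -> : partial_link k c 0 = set0 by apply: has_homology_set0.
  by apply/setP => s; rewrite [RHS]inE; apply/partial_linkP => -[i []].
rewrite partial_linkS; case: ifP => ct; last by apply: IH; lia.
suff [x xF HF] : exists2 x, x \in arc (k + t) :\: c &
    forall s, s \subset arc (k + t) :\: c -> s \in partial_link k c t ->
      x |: s \in partial_link k c t.
  rewrite (has_homology_add_cone K (@downclosed_partial_link k c t) xF HF).
  by apply: IH; lia.
have [E|/set0Pn[s0 /partial_linkP[i [it ci _]]]] := eqVneq (partial_link k c t) set0.
  (* The first arc over [c] is attached to the void family, and any of its points outside [c] is an
     apex. *)
  have /properP[_ [x xt xc]] : c \proper arc (k + t).
    rewrite properE ct; apply: contra cF => tc.
    by rewrite -(card_arc a_gt0 b_gt0 (k + t)) eqn_leq !subset_leq_card.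
  by exists x => [|s _]; rewrite ?E inE // xt xc.
(* Now [c] lies in arc [t] and its predecessor but is not their intersection; a further common point
   is the apex. *)
have ct1 : c \subset arc (k + t.-1) by apply: (sub_arc_pred _ _ ci ct); lia.
have /properP[_ [x]] : c \proper arc (k + t.-1) :&: arc (k + t.-1).+1.
  rewrite properE -addnS prednK ?(leq_ltn_trans _ it) // subsetI ct1 ct /=.
  apply: contra_notN (cI (k + t.-1)) => tc; apply/eqP.
  by rewrite eqEsubset -addnS prednK ?(leq_ltn_trans _ it) // subsetI ct1 ct.
rewrite -addnS prednK ?(leq_ltn_trans _ it) // inE => /andP[xt1 xt] xc.
exists x => [|s]; first by rewrite inE xc.
rewrite subsetD => /andP[st sc] /partial_linkP[l [lt cl]].
rewrite subsetD => /andP[sl _]; apply/partial_linkP; exists t.-1; split=> //.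
  by move: lt; clear; lia.
rewrite subUset sub1set inE xc xt1 subsetD sc !andbT /=.
by apply: (sub_arc_pred _ _ sl st); move: lt tm; clear; lia.
Qed.

Lemma mem_link k c s : reflect
    (exists t, [/\ t < N, c \subset arc (k + t) & s \subset arc (k + t) :\: c])
  (s \in link (cycle_complex a b) c).
Proof.
rewrite inE; apply: (iffP and3P) => [[_ cs /(mem_cycle_complex a_gt0 b_gt0 k)[t tN]]|].
  rewrite subUset => /andP[ct st]; exists t; split=> //.
  by rewrite subsetD st disjoint_sym.
move=> [t [tN ct]]; rewrite subsetD => /andP[st sc]; split; first 1 last.
- by rewrite disjoint_sym.
- by apply/(mem_cycle_complex a_gt0 b_gt0 k); exists t; rewrite // subUset ct.
- by apply/(mem_cycle_complex a_gt0 b_gt0 k); exists t.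
Qed.

Lemma has_homology_link_facet c j : c \in cycle_complex a b -> #|c| = a + b ->
  has_homology K (link (cycle_complex a b) c) j = (j == 0).
Proof.
move=> /(mem_cycle_complex a_gt0 b_gt0 0)[t0 t0N ct0] cF.
suff -> : link (cycle_complex a b) c = powerset set0.
  by rewrite has_homology_powerset eqxx.
apply/setP => s; rewrite powersetE subset0; apply/(mem_link 0)/eqP => [[t [tN ct]]|->].
  suff -> : c = arc (0 + t) by rewrite setDv subset0 => /eqP.
  by apply/eqP; rewrite eqEcard ct cF (card_arc a_gt0 b_gt0) leqnn.
by exists t0; rewrite sub0set.
Qed.

Lemma has_homology_link_ridge k j :
  has_homology K (link (cycle_complex a b) (arc k :&: arc k.+1)) j = (j == 1).
Proof.
set c := arc k :&: arc k.+1; have cA := card_arc a_gt0 b_gt0.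
have cE : #|c| = a by apply: card_arcI.
have c0 : c \subset arc k by apply: subsetIl.
have c1 : c \subset arc k.+1 by apply: subsetIr.
have nonempty i : c \subset arc i -> arc i :\: c != set0.
  by move=> ci; rewrite -card_gt0 cardsD (setIidPr ci) cA cE; lia.
suff -> : link (cycle_complex a b) c = powerset (arc k :\: c) :|: powerset (arc k.+1 :\: c).
  apply: has_homology_two_simplices; [exact: nonempty | exact: nonempty |].
  rewrite -setI_eq0; apply/eqP/setP => x; rewrite /c !(in_setI, in_setD, in_set0).
  by case: (x \in arc k); case: (x \in arc k.+1).
have rb := @r_leb a b b_gt0.
apply/setP => s; rewrite in_setU !powersetE; apply/(mem_link k)/orP => [[t [tN ct]]|[]]; last 2 first.
- by exists 0; rewrite addn0 addn3.
- by exists 1; rewrite addn1 addn3.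
suff: t <= 1 by case: t {tN ct} => [|[|]] // _; rewrite ?addn0 ?addn1; [left|right].
(* All coordinates are realised by points, so the inclusion of [c] in arc [t] can be tested on
   chosen coordinates. *)
have inc q o : q < N -> o < b -> in_arc 0 q o -> in_arc 1 q o -> in_arc t q o.
  move=> qN ob; have [x [<- <-]] := exists_block a_gt0 b_gt0 k qN ob => x0 x1.
  rewrite -mem_arc //; apply: (subsetP ct); rewrite in_setI -{1}[k]addn0 -addn1.
  by rewrite !mem_arc ?addn3 // x0 x1.
(* The first and the last point of c lie in no other facet. *)
have first : in_arc t 1 0 by apply: inc => //; rewrite ?addn3 // /in_arc; case: (m).
have last : in_arc t m.+1 r.-1.
  by apply: inc => //; rewrite /in_arc ?leqnn ?eqxx ?orbT //=; lia.
by move: first last tN; rewrite /in_arc; case: (leqP t 1); case: (leqP t m.+1); lia.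
Qed.

Lemma exists_origin x : exists k, block k x = m.+1.
Proof.
(* Since [m.+1 + m.+2 = N], adding [m.+2] amounts to going back [m.+1] blocks. *)
exists (x %/ b + m.+2); apply: blockP => //; first by lia.
have -> : m.+1 + (x %/ b + m.+2) = N + x %/ b by lia.
by rewrite modnDl.
Qed.

(** An arc starting after block [m.+1] reaches that block only after at least [m.+2] steps, so it
    misses [x]. *)
Lemma link_partial_link k c x : x \in c -> block k x = m.+1 ->
  link (cycle_complex a b) c = partial_link k c m.+2.
Proof.
move=> xc xq; apply/setP => s; apply/(mem_link k)/partial_linkP => -[t [tN ct st]];
  exists t; split=> //; last by lia.
have := subsetP ct x xc; rewrite mem_arc // xq /in_arc.
by case: (leqP t m.+1) => // tm; lia.
Qed.

(** * The whole complex, as the link of the empty face *)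

Lemma link_set0 (D : {set {set 'I_n}}) : link D set0 = D.
Proof. by apply/setP => s; rewrite inE set0U disjoints_subset sub0set andbb. Qed.

Local Notation arcs t := (@partial_link 0 set0 t).

Lemma mem_arcs t s : reflect (exists2 i, i < t & s \subset arc i) (s \in arcs t).
Proof.
apply: (iffP (partial_linkP _ _ _ _)) => [[i [it _]]|[i it si]].
  by rewrite setD0; exists i.
by exists i; split; rewrite ?setD0 ?sub0set.
Qed.

Lemma arcsS t : arcs t.+1 = arcs t :|: powerset (arc t).
Proof. by rewrite partial_linkS sub0set setD0. Qed.

Lemma arcI_neq0 i : set0 <> arc i :&: arc i.+1.
Proof. by move=> /(congr1 (fun s => #|s|)); rewrite cards0 card_arcI //; lia. Qed.

(* Up to block m + 1 each arc meets the union of the previous ones in a simplex.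
   The arc at m + 2 closes the circle: it meets the previous ones in two disjoint
   simplices, with vertices y and x; attaching the edge between them creates the
   class, and the remaining faces are attached along cones. *)
Lemma has_homology_arcs t j : m.+3 <= t <= N -> has_homology K (arcs t) j = (j == 2).
Proof.
have arcs_dc u : downclosed (arcs u) by apply: downclosed_partial_link.
(* The ends of the closing edge: [x] opens block 0 and lies in arc 0 and all arcs from [m.+2] on;
   [y] opens block [m.+2] and lies in arcs [m.+1] and [m.+2]. *)
have [x [xq xo]] : exists x : 'I_n, block 0 x = 0 /\ x %% b = 0.
  by apply: exists_block => //; lia.
have [y [yq yo]] : exists y : 'I_n, block 0 y = m.+2 /\ y %% b = 0.
  by apply: exists_block => //; lia.
have xP i : i < N -> (x \in arc i) = in_arc i 0 0.
  by move=> iN; rewrite -[arc i]/(arc (0 + i)) mem_arc // xq xo.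
have yP i : i < N -> (y \in arc i) = in_arc i m.+2 0.
  by move=> iN; rewrite -[arc i]/(arc (0 + i)) mem_arc // yq yo.
have x0 : x \in arc 0 by rewrite xP ?addn3.
have x_late i : m.+2 <= i < N -> x \in arc i.
  move=> /andP[mi iN]; rewrite xP // /in_arc; move: mi iN; clear.
  by case: (leqP i 0); lia.
elim: t => [//|t IH] /andP[mt tN]; rewrite arcsS.
have [tm|mt'] := eqVneq t m.+2; last first.
  rewrite (has_homology_add_cone K (@arcs_dc t) (x := x)).
  - by apply: IH; lia.
  - by apply: x_late; lia.
  move=> s st /mem_arcs[i it si]; apply/mem_arcs.
  (* Near arcs meet arc [t] inside arc [t.-1], far ones inside arc 0; both of these contain [x]. *)
  have [ti|it'] := leqP t (i + m.+1).
    exists t.-1; first lia.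
    rewrite subUset sub1set x_late; last lia.
    by apply: (@sub_arc_pred 0 i t s) => //; lia.
  exists 0; first lia.
  by rewrite subUset sub1set x0; apply: (@sub_arc_first 0 i t s).
rewrite {t mt tN IH}tm.
(* Three stages: the edge [e], then the simplex [G] with apex [y], then the whole arc with apex
   [x]. *)
set e := [set x; y]; set c := arc m.+1 :&: arc m.+2; set G := x |: c.
have yc : y \in c.
  rewrite in_setI !yP /in_arc; try by clear; lia.
  by rewrite leqnn leqnSn subnn subSnn /=; case: m.
have xy : x != y by apply: contra_eq_neq xq => ->; rewrite yq.
have x_early i : i < m.+2 -> x \in arc i -> i = 0.
  move=> im; rewrite xP /in_arc; last by move: im; clear; lia.
  move: im; clear; case: (leqP i 0); lia.
have cG : c \subset G by apply: subsetUr.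
have eG : e \subset G by rewrite subUset !sub1set setU11 setU1r.
have GF : G \subset arc m.+2 by rewrite subUset sub1set x_late ?subsetIr //; lia.
(* The points of [c] lie in blocks from [m.+2] on, those of arc 0 in blocks up to [m.+1]. *)
have c0 : [disjoint c & arc 0].
  rewrite -setI_eq0; apply/eqP/setP => z; rewrite in_set0 !in_setI.
  rewrite -[arc 0]/(arc (0 + 0)) -[arc m.+1]/(arc (0 + m.+1)) -[arc m.+2]/(arc (0 + m.+2)).
  rewrite !mem_arc //; try by clear; lia.
  have := block_lt 0 z; move: (block 0 z) (z %% b) => q o; rewrite /in_arc leq0n; clear.
  by case: (leqP m.+1 q) => ?; case: (leqP m.+2 q) => ?; lia.
have eN : e \notin arcs m.+2.
  apply/mem_arcs => -[i im]; rewrite subUset !sub1set => /andP[/(x_early _ im)->].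
  by rewrite (disjointFr c0 yc).
have D1dc : downclosed (e |: arcs m.+2).
  move=> s u /setU1P[->|sD] us; last by rewrite setU1r // (arcs_dc _ _ _ sD us).
  have [->|ue] := eqVneq u e; first exact: setU11.
  apply/setU1r/mem_arcs.
  (* A proper face of the edge misses [x] and lies in arc [m.+1], or misses [y] and lies in arc
     0. *)
  have [xu|xu] := boolP (x \in u); last first.
    exists m.+1 => //; apply/subsetP => z zu; have := subsetP us z zu.
    rewrite in_set2 => /orP[]/eqP zE; first by rewrite -zE zu in xu.
    by move: yc; rewrite zE in_setI => /andP[].
  exists 0 => //; apply/subsetP => z zu; have := subsetP us z zu.
  rewrite in_set2 => /orP[/eqP->//|/eqP zE].
  by case/negP: ue; rewrite eqEsubset us subUset !sub1set xu -zE.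
have D2dc : downclosed ((e |: arcs m.+2) :|: powerset G).
  by apply: downclosedU => //; apply: downclosed_powerset.
have -> : arcs m.+2 :|: powerset (arc m.+2) =
    ((e |: arcs m.+2) :|: powerset G) :|: powerset (arc m.+2).
  apply/setP => s; rewrite !in_setU in_set1 !powersetE.
  have [->|_] := eqVneq s e; first by rewrite (subset_trans eG GF) !orbT.
  have [sG|_] := boolP (s \subset G); last by rewrite orbF.
  by rewrite (subset_trans sG GF) !orbT.
have toc s i : 0 < i < m.+2 -> s \subset arc m.+2 -> s \subset arc i -> s \subset c.
  move=> i0 sF si; rewrite subsetI sF andbT.
  by apply: (@sub_arc_pred 0 i m.+2 s) => //; move: i0; clear; lia.
rewrite (has_homology_add_cone K D2dc (x := x)); first last.
- move=> s sF; rewrite !in_setU !in_set1 !powersetE.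
  rewrite subUset sub1set setU11 /=.
  case/orP => [/orP[/eqP->|]|sG]; last by rewrite sG orbT.
    by rewrite (setUidPr (_ : [set x] \subset e)) ?sub1set ?set21 ?eqxx.
  move=> /mem_arcs[[|i] im si]; last by rewrite (subset_trans (toc _ i.+1 _ sF si) cG) ?orbT.
  apply/orP; left; apply/orP; right; apply/mem_arcs; exists 0 => //.
  by rewrite subUset sub1set x0.
- by apply: x_late; clear; lia.
rewrite (has_homology_add_cone K D1dc (x := y)); first last.
- move=> s sG sD.
  (* An old face inside [G] that comes from arc 0 is at most the point [x]; one from a later arc
     lies in [c]. Both [e] and [c] contain [y]. *)
  have [s_e|sc] : s \subset e \/ s \subset c.
    case/setU1P: sD => [->|/mem_arcs[[|i] im si]]; [by left | left | right].
      apply/subsetP => z zs; have /setU1P[->|zc] := subsetP sG z zs; first exact: set21.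
      by have := disjointFr c0 zc; rewrite (subsetP si).
    by apply: (toc _ i.+1) si => //; apply: subset_trans GF.
  - by apply: (D1dc e); rewrite ?setU11 // subUset sub1set set22.
  - apply/setU1r/mem_arcs; exists m.+1 => //; rewrite subUset sub1set.
    by rewrite (subset_trans sc) ?subsetIl // andbT (subsetP (subsetIl _ _) _ yc).
- by rewrite setU1r.
rewrite has_homology_add_cell //; first by rewrite cards2 xy.
move=> i; apply: partial_link_acyclic => //; first by rewrite cards0 eq_sym -lt0n addn_gt0 a_gt0.
exact: arcI_neq0.
Qed.

Lemma has_homology_cycle_complex j :
  has_homology K (cycle_complex a b) j = (j == 2).
Proof.
suff -> : cycle_complex a b = arcs N by rewrite has_homology_arcs // leqnn andbT; lia.
by apply/setP => s; apply/(mem_cycle_complex a_gt0 b_gt0 0)/mem_arcs.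
Qed.

(** * The PR property and the degree type *)

Lemma has_homology_link c j : c \in cycle_complex a b ->
  has_homology K (link (cycle_complex a b) c) j ->
  [\/ j = 2 /\ #|c| = 0, j = 1 /\ #|c| = a | j = 0 /\ #|c| = a + b].
Proof.
move=> cD; have [->|/set0Pn[x xc]] := eqVneq c set0.
  by rewrite link_set0 has_homology_cycle_complex cards0 => /eqP; constructor 1.
have [cF|cF] := eqVneq #|c| (a + b).
  by rewrite has_homology_link_facet // => /eqP; constructor 3.
(* Indices below [N] suffice, as [arc] depends on its index modulo [N]. *)
have [/existsP[i /eqP->]|cI] := boolP [exists i : 'I_N, c == arc i :&: arc i.+1].
  by rewrite has_homology_link_ridge // card_arcI // => /eqP; constructor 2.
have [k xk] := exists_origin x.
rewrite (link_partial_link xc xk) partial_link_acyclic // => i cE.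
case/existsP: cI; have iN : i %% N < N by rewrite ltn_mod addn3.
exists (Ordinal iN); rewrite cE (@arc_mod _ _ i (i %% N)) ?modn_mod //.
by rewrite (@arc_mod _ _ i.+1 (i %% N).+1) // -addn1 -[in RHS]addn1 modnDml.
Qed.

End CycleComplexHomology.

Local Open Scope ring_scope.

Theorem theorem5p14 (K : fieldType) (a b : nat) (ha : (0 < a)%N) (hb : (0 < b)%N) :
  PR K (cycle_complex a b) /\
  degree_type K (cycle_complex a b) = [:: Posz a; Posz b].
Proof.
have link_homology := @has_homology_link K a b ha hb.
set D := cycle_complex a b.
have facesP j s : reflect (s \in D /\ has_homology K (link D s) j) (s \in homology_faces K D j).
  by rewrite inE; apply: andP.
(* A witness [s] is required because the maximum over an empty set of faces would default to 0. *)
have size_eq j s v : s \in homology_faces K D j -> #|s| = v ->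
    (forall t, t \in homology_faces K D j -> #|t| = v) -> PR_size K D j = v.
  move=> sj sv all_v; apply/eqP; rewrite eqn_leq; apply/andP; split.
    by apply/bigmax_leqP => t /all_v->.
  by rewrite -sv /PR_size (bigD1 s) //= leq_maxl.
have f2 : set0 \in homology_faces K D 2.
  apply/facesP; split; first by case: (cycle_complexP a b).
  by rewrite link_set0 has_homology_cycle_complex.
have arcD i : arc a b i \in D.
  apply/(mem_cycle_complex ha hb i); exists 0%N; rewrite ?addn3 //.
  by rewrite addn0.
have f1 : arc a b 0 :&: arc a b 1 \in homology_faces K D 1.
  apply/facesP; split; last by rewrite has_homology_link_ridge.
  by case: (cycle_complexP a b) => _; apply; [exact: (arcD 0%N) | exact: subsetIl].
have f0 : arc a b 0 \in homology_faces K D 0.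
  apply/facesP; split; first exact: arcD.
  by rewrite has_homology_link_facet ?card_arc.
have index2 : PR_index K D = 2%N.
  apply/eqP; rewrite eqn_leq; apply/andP; split.
    apply/bigmax_leqP => j /set0Pn[s /facesP[sD]].
    by move=> /(link_homology _ _ sD)[] [->].
  have n2 : (2 < (cycle_order a b).+1)%N by rewrite /cycle_order; nia.
  apply: (@leq_bigmax_cond _ _ (fun j : 'I__ => nat_of_ord j) (Ordinal n2)).
  by apply/set0Pn; exists set0.
split=> [j s t sD tD|].
  by move=> /(link_homology _ _ sD)[] [-> ->] /(link_homology _ _ tD)[] [].
rewrite /degree_type index2 /=.
(* The sizes at indices 2, 1, 0 are [0], [a], [a + b], with successive differences [a] and [b]. *)
rewrite (size_eq 2%N _ 0%N f2) ?cards0 //; last by move=> t /facesP[tD /(link_homology _ _ tD)[] []].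
rewrite (size_eq 1%N _ a f1) ?card_arcI //; last by move=> t /facesP[tD /(link_homology _ _ tD)[] []].
rewrite (size_eq 0%N _ (a + b)%N f0) ?card_arc //; last by move=> t /facesP[tD /(link_homology _ _ tD)[] []].
by rewrite subr0 PoszD addrC addKr.
Qed.
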